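(* Let $\prec$ be a compatible partial preference on a real vector space $Y$, let $P_\prec$ be its positive cone and $\mathcal{O}(P_\prec)$ the set of open components of $P_\prec$. Then the family $\mathcal{T}(\prec):=\{\prec_E \mid E\in\mathcal{O}(P_\prec)\}$ consists of relatively open compatible partial preferences on $Y$, and with respect to the partial order $\unlhd'$ the family $\mathcal{T}(\prec)$ is an upper lattice (every two-element subset has a least upper bound) with $\sup\{\prec_{E_1},\prec_{E_2}\}=\prec_{E_1\vee E_2}$ for all $E_1,E_2\in\mathcal{O}(P_\prec)$, where $E_1\vee E_2$ denotes the least upper bound of $\{E_1,E_2\}$ in $(\mathcal{O}(P_\prec),\unlhd^* )$. Moreover, for $y,z\in Y$, $y\prec z$ if and only if there exists $\prec_E\,\in\mathcal{T}(\prec)$ such that $y\prec_E z$.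
   Context: A partial preference on a real vector space $Y$ is an asymmetric and transitive binary relation $\prec$ on $Y$. It is compatible if $y_1\prec y_2$ implies $\lambda y_1\prec\lambda y_2$ and $y_1+y\prec y_2+y$ for all $y\in Y$ and all real $\lambda>0$. Its positive cone is $P_\prec=\{y\in Y\mid 0\prec y\}$; it is an asymmetric convex cone ($P_\prec\cap(-P_\prec)=\varnothing$, $P_\prec+P_\prec\subset P_\prec$, $\lambda P_\prec\subset P_\prec$ for $\lambda>0$), and $y_1\prec y_2\iff y_2-y_1\in P_\prec$. Majorization: for $y,z\in P_\prec$ write $y\unlhd z$ if there is a real $\mu>0$ with $\mu y\prec z$. This is a preorder on $P_\prec$; write $y\approx z$ if $y\unlhd z$ and $z\unlhd y$. The set of equivalence classes $\mathcal{O}(P_\prec)=P_\prec/\!\approx$ is called the set of open components of $P_\prec$. It is partially ordered by $\unlhd^*$: $E_1\unlhd^*E_2$ iff $y_1\unlhd y_2$ for all (equivalently, some) $y_1\in E_1$, $y_2\in E_2$. For $E\in\mathcal{O}(P_\prec)$ the relation $\prec_E$ on $Y$ is defined by $y_1\prec_E y_2\iff y_2-y_1\in E$. On $\mathcal{T}(\prec)$ the order $\unlhd'$ is defined by $\prec_{E_1}\unlhd'\prec_{E_2}\iff E_1\unlhd^*E_2$. The relative algebraic interior (intrinsic core) $\mathrm{icr}\,Q$ of $Q\subset Y$ is the set of $z\in Q$ such that for every $y\in\mathrm{aff}\,Q\setminus\{z\}$ ($\mathrm{aff}$ = affine hull) there is $\delta>0$ with $z+t(y-z)\in Q$ for all $t\in(-\delta,\delta)$.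 A compatible partial preference is relatively open if its positive cone $P$ satisfies $\mathrm{icr}\,P\neq\varnothing$ and $P=\mathrm{icr}\,P$. *)

(* Defs.v *)
From mathcomp Require Import all_boot all_order all_algebra.
From mathcomp Require Import boolp classical_sets reals.

Set Implicit Arguments.
Unset Strict Implicit.
Unset Printing Implicit Defensive.

Import Order.TTheory GRing.Theory Num.Theory.
Local Open Scope classical_set_scope.
Local Open Scope ring_scope.

Section PosetSubset.
Context {T : Type}.
Implicit Types (A S : set T) (le : T -> T -> Prop).

Definition partial_order_on A le : Prop :=
  [/\ forall x, A x -> le x x,
      forall x y, A x -> A y -> le x y -> le y x -> x = y &
      forall x y z, A x -> A y -> A z -> le x y -> le y z -> le x z].

(* [m] is the supremum of [S] in the poset [(A, le)]: both [m] and the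
   competing upper bounds range over [A]. *)
Definition is_lub_in A le S (m : T) : Prop :=
  [/\ A m,
      forall x, S x -> le x m &
      forall b, A b -> (forall x, S x -> le x b) -> le m b].

Definition upper_lattice A le : Prop :=
  partial_order_on A le /\
  forall x y, A x -> A y -> x <> y -> exists m, is_lub_in A le [set x; y] m.

End PosetSubset.

Section Preferences.
Context {R : realType} {Y : lmodType R}.
Implicit Types (r s : Y -> Y -> Prop) (Q E : set Y).

Definition partial_preference r : Prop :=
  (forall x y, r x y -> ~ r y x) /\ (forall x y z, r x y -> r y z -> r x z).

Definition compatible r : Prop :=
  forall y1 y2, r y1 y2 ->
    (forall l : R, 0 < l -> r (l *: y1) (l *: y2)) /\
    (forall y, r (y1 + y) (y2 + y)).

Definition compatible_partial_preference r : Prop :=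
  partial_preference r /\ compatible r.

Definition positive_cone r : set Y := [set y | r 0 y].

Definition affine_set Q : Prop :=
  forall x y (t : R), Q x -> Q y -> Q ((1 - t) *: x + t *: y).

Definition aff Q : set Y := smallest affine_set Q.

Definition icr Q : set Y :=
  [set z | Q z /\
    forall y, aff Q y -> y <> z ->
      exists2 d : R, 0 < d &
        forall t : R, - d < t < d -> Q (z + t *: (y - z))].

Definition relatively_open r : Prop :=
  icr (positive_cone r) !=set0 /\ positive_cone r = icr (positive_cone r).

(* Majorization is only meant for [y] and [z] in [positive_cone r]. *)
Definition majorized r (y z : Y) : Prop :=
  exists2 mu : R, 0 < mu & r (mu *: y) z.

Definition maj_equiv r (y z : Y) : Prop := majorized r y z /\ majorized r z y.

Definition open_component_of r (y : Y) : set Y :=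
  [set z | positive_cone r z /\ maj_equiv r y z].

(* The quotient of the positive cone by [maj_equiv r], each equivalence class
   being represented by the subset of [Y] that it is. *)
Definition open_components r : set (set Y) :=
  [set open_component_of r y | y in positive_cone r].

Definition component_le r (E1 E2 : set Y) : Prop :=
  forall y1 y2, E1 y1 -> E2 y2 -> majorized r y1 y2.

Definition pref_of E : Y -> Y -> Prop := fun y1 y2 => E (y2 - y1).

Definition component_prefs r : set (Y -> Y -> Prop) :=
  [set pref_of E | E in open_components r].

(* [pref_of] is injective, so the components are determined by the relations
   they define; see [component_pref_leE]. *)
Definition component_pref_le r (s1 s2 : Y -> Y -> Prop) : Prop :=
  exists E1 E2, [/\ open_components r E1, open_components r E2,
    s1 = pref_of E1, s2 = pref_of E2 & component_le r E1 E2].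

Lemma pref_of_inj : injective pref_of.
Proof.
move=> E1 E2 eqE; apply/funext => y.
by have := congr1 (fun s => s 0 y) eqE; rewrite /pref_of subr0.
Qed.

Lemma component_pref_leE r E1 E2 :
  open_components r E1 -> open_components r E2 ->
  component_pref_le r (pref_of E1) (pref_of E2) <-> component_le r E1 E2.
Proof.
move=> O1 O2; split=> [[F1 [F2 [_ _ /pref_of_inj -> /pref_of_inj ->]]] //|le12].
by exists E1, E2.
Qed.

End Preferences.

(* Main.v *)
(** For [y] in the positive cone, the vectors dominated together with their
    opposites by a multiple of [y] form a linear subspace [dominated y], which
    therefore contains the affine hull of the open component of [y].  A vector [z]
    of the component satisfies [e y < z] for some [e > 0], so it may be moved by a
    small multiple of any dominated vector without leaving the component: this is
    relative openness.  The supremum of the components of [y] and [z] is the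
    component of [y + z], because [y] and [z] are majorized by [w] if and only if
    their sum is. *)
Require Import Defs.
From mathcomp Require Import all_boot all_order all_algebra.
From mathcomp Require Import boolp classical_sets reals.
From mathcomp Require Import lra.

Import Order.TTheory GRing.Theory Num.Theory.

Local Open Scope classical_set_scope.
Local Open Scope ring_scope.

Section CompatiblePreference.
Context {R : realType} {Y : lmodType R} {r : Y -> Y -> Prop}.
Hypothesis hr : compatible_partial_preference r.

Local Notation P := (positive_cone r).
Local Notation "[ 'comp' y ]" := (open_component_of r y) (format "[ 'comp'  y ]").

(** * Arithmetic of the preference and its positive cone *)

Lemma pref_trans {x y z} : r x y -> r y z -> r x z.
Proof. by case: hr => -[_ tr] _; apply: tr. Qed.

Lemma pref_addr {x y} z : r x y -> r (x + z) (y + z).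
Proof. by case: hr => _ /[apply] -[_]. Qed.

Lemma pref_scale {x y} {l : R} : 0 < l -> r x y -> r (l *: x) (l *: y).
Proof. by move=> l0; case: hr => _ /[apply] -[+ _]; apply. Qed.

Lemma pref_add {x y z w} : r x y -> r z w -> r (x + z) (y + w).
Proof.
move=> rxy rzw; apply: pref_trans (pref_addr z rxy) _.
by rewrite ![y + _]addrC; apply: pref_addr.
Qed.

Lemma cone_sub {x y} : r x y -> P (y - x).
Proof. by move=> /(pref_addr (- x)); rewrite subrr. Qed.

Lemma pref_of_cone_sub {x y} : P (y - x) -> r x y.
Proof. by move=> /(pref_addr x); rewrite add0r subrK. Qed.

Lemma cone_add {x y} : P x -> P y -> P (x + y).
Proof. by move=> /pref_add/[apply]; rewrite addr0. Qed.

Lemma cone_scale {x} {l : R} : 0 < l -> P x -> P (l *: x).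
Proof. by move=> l0 /(pref_scale l0); rewrite scaler0. Qed.

Lemma pref_scale_lt {y} {a b : R} : P y -> a < b -> r (a *: y) (b *: y).
Proof.
by move=> Py ab; apply: pref_of_cone_sub; rewrite -scalerBl; apply: cone_scale; rewrite ?subr_gt0.
Qed.

Lemma pref_scale_le {y z} {a b : R} : P y -> a <= b -> r (b *: y) z -> r (a *: y) z.
Proof.
move=> Py; rewrite le_eqVlt => /predU1P[-> //|ab].
exact: pref_trans (pref_scale_lt Py ab).
Qed.

Lemma cone_of_pref {y z} {a : R} : P y -> 0 < a -> r (a *: y) z -> P z.
Proof. by move=> Py a0; apply: pref_trans; apply: cone_scale. Qed.

(** * Majorization on the positive cone *)

Lemma majorized_refl {y} : P y -> majorized r y y.
Proof.
(* The factor 1 is excluded by asymmetry; any factor strictly between 0 and 1 works. *)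
move=> Py; exists 2^-1; first lra.
by rewrite -[X in r _ X]scale1r; apply: pref_scale_lt => //; lra.
Qed.

Lemma majorized_trans {x y z} : majorized r x y -> majorized r y z -> majorized r x z.
Proof.
move=> [a a0 rxy] [b b0 ryz]; exists (b * a); first exact: mulr_gt0.
by rewrite -scalerA; apply: pref_trans ryz; apply: pref_scale.
Qed.

Lemma majorized_addr {x y} z : P z -> majorized r x y -> majorized r x (y + z).
Proof.
by move=> Pz [a a0 rxy]; exists a => //; rewrite -[a *: x]addr0; apply: pref_add.
Qed.

(** With the smaller factor [m] of the two, both [m x] and [m y] lie below [z], hence so does their
    average. This is what makes the component of a sum the least upper bound. *)
Lemma majorized_add {x y z} :
  P x -> P y -> majorized r x z -> majorized r y z -> majorized r (x + y) z.
Proof.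
move=> Px Py [a a0 rxz] [b b0 ryz].
have m0 : 0 < Num.min a b by rewrite lt_min a0.
have mx : r (Num.min a b *: x) z by apply: (pref_scale_le Px) rxz; rewrite ge_min lexx.
have my : r (Num.min a b *: y) z.
  by apply: (pref_scale_le Py) ryz; rewrite ge_min lexx orbT.
exists (2^-1 * Num.min a b); first by apply: mulr_gt0 => //; lra.
rewrite -scalerA scalerDr.
have -> : z = 2^-1 *: (z + z).
  by rewrite -mulr2n -scaler_nat scalerA mulVf ?scale1r// pnatr_eq0.
by apply: pref_scale; [lra|apply: pref_add].
Qed.

Lemma majorized_scaler {y z} {l : R} : 0 < l -> majorized r y z -> majorized r y (l *: z).
Proof.
move=> l0 [a a0 h]; exists (l * a); first exact: mulr_gt0.
by rewrite -scalerA; apply: pref_scale.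
Qed.

Lemma majorized_scalel {y z} {l : R} : 0 < l -> majorized r y z -> majorized r (l *: y) z.
Proof.
move=> l0 [a a0 h]; exists (a / l); first exact: divr_gt0.
by rewrite scalerA divfK ?gt_eqF.
Qed.

(** * Open components as convex cones, and the preferences they define *)

Lemma component_id {y} : P y -> [comp y] y.
Proof. by move=> Py; split=> //; split; apply: majorized_refl. Qed.

Lemma component_add {y z w} : [comp y] z -> [comp y] w -> [comp y] (z + w).
Proof.
move=> [Pz [yz zy]] [Pw [_ wy]]; split; first exact: cone_add.
by split; [apply: majorized_addr|apply: majorized_add].
Qed.

Lemma component_scale {y z} {l : R} : 0 < l -> [comp y] z -> [comp y] (l *: z).
Proof.
move=> l0 [Pz [yz zy]]; split; first exact: cone_scale.
by split; [apply: majorized_scaler|apply: majorized_scalel].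
Qed.

Lemma positive_cone_pref_of (E : set Y) : positive_cone (pref_of E) = E.
Proof. by apply/funext => y; rewrite /positive_cone /pref_of /= subr0. Qed.

Lemma pref_of_component_compatible y :
  compatible_partial_preference (pref_of [comp y]).
Proof.
split; first split.
(* A component lies inside the cone, so its asymmetry is inherited from [r]. *)
- move=> a b [/pref_of_cone_sub rab _] [/pref_of_cone_sub rba _].
  by case: hr => -[asym _] _; apply: asym rab rba.
- move=> a b c Eab Ebc; rewrite /pref_of.
  by have := component_add Ebc Eab; rewrite addrA subrK.
move=> a b Eab; split=> [l l0|c]; rewrite /pref_of.
  by rewrite -scalerBr; apply: component_scale.
by rewrite opprD addrACA subrr addr0.
Qed.

(** * The order ideal of [y], that is, all [w] with [- a y < w < a y] for some [a > 0], and relative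
    openness *)

Definition dominated (y : Y) : set Y :=
  [set w | exists2 a : R, 0 < a & r w (a *: y) /\ r (- w) (a *: y)].

Lemma dominated_add {y u v} : dominated y u -> dominated y v -> dominated y (u + v).
Proof.
move=> [a a0 [ua ua']] [b b0 [vb vb']]; exists (a + b); first exact: addr_gt0.
by rewrite scalerDl opprD; split; apply: pref_add.
Qed.

Lemma dominated_opp {y v} : dominated y v -> dominated y (- v).
Proof. by move=> [a a0 [va va']]; exists a => //; rewrite opprK. Qed.

Lemma dominated_scale_gt0 {y v} {t : R} : 0 < t -> dominated y v -> dominated y (t *: v).
Proof.
move=> t0 [a a0 [va va']]; exists (t * a); first exact: mulr_gt0.
by rewrite -scalerN -scalerA; split; apply: pref_scale.
Qed.

Lemma dominated_scale {y v} (t : R) : P y -> dominated y v -> dominated y (t *: v).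
Proof.
move=> Py dv; have [t0|t0|->] := ltgtP t 0; last first.
(* The zero vector is dominated because [y] itself is positive. *)
- by exists 1 => //; rewrite scale0r oppr0 scale1r; split.
- exact: dominated_scale_gt0.
- rewrite -[t]opprK scaleNr; apply/dominated_opp/dominated_scale_gt0 => //.
  by rewrite oppr_gt0.
Qed.

(** The bound on [- z] comes for free: [- z < 0 < a^-1 y], since [z] and [y] are positive. *)
Lemma majorized_dominated {y z} : P y -> P z -> majorized r z y -> dominated y z.
Proof.
move=> Py Pz [a a0 rzy]; exists a^-1; first by rewrite invr_gt0.
have rz : r z (a^-1 *: y).
  have := pref_scale (_ : 0 < a^-1) rzy; rewrite scalerA mulVf ?gt_eqF// scale1r.
  by apply; rewrite invr_gt0.
split=> //; apply: pref_trans (cone_scale _ Py); last by rewrite invr_gt0.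
by apply: pref_of_cone_sub; rewrite opprK add0r.
Qed.

Lemma dominated_majorized {y z} : dominated y z -> majorized r z y.
Proof.
move=> [a a0 [rz _]]; exists a^-1; first by rewrite invr_gt0.
have := pref_scale (_ : 0 < a^-1) rz; rewrite scalerA mulVf ?gt_eqF// scale1r.
by apply; rewrite invr_gt0.
Qed.

Lemma aff_component {y} : P y -> aff [comp y] `<=` dominated y.
Proof.
(* The affine hull is an intersection, so it is enough that [dominated y] is itself affine and
   contains the component. *)
move=> Py w; apply; split=> [u v t du dv|z [Pz [_ zy]]].
  by apply: dominated_add; apply: dominated_scale.
exact: majorized_dominated.
Qed.

(** If [v] and [- v] are both below [a y], then for nonzero [t] the vector [t v] is below [|t| a y],
    which is below [e y] once [|t| < e / a]. *)
Lemma dominated_small {y v} {e : R} : P y -> 0 < e -> dominated y v ->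
  exists2 d : R, 0 < d & forall t : R, - d < t < d -> r (t *: v) (e *: y).
Proof.
move=> Py e0 [a a0 [va va']]; exists (e / a); first exact: divr_gt0.
move=> t /andP[]; rewrite ltrNl !ltr_pdivlMr// => ta' ta.
have [t0|t0|->] := ltgtP t 0; last by rewrite scale0r; apply: cone_scale.
- apply: pref_trans (pref_scale_lt Py ta').
  by rewrite -[t *: v]opprK -scaleNr -scalerN -scalerA; apply: pref_scale; rewrite ?oppr_gt0.
- by apply: pref_trans (pref_scale_lt Py ta); rewrite -scalerA; apply: pref_scale.
Qed.

Lemma icr_component {y} : P y -> icr [comp y] = [comp y].
Proof.
move=> Py; apply/seteqP; split=> [z []//|z Ez]; split=> // w /(aff_component Py) dw _.
have [Pz [[e e0 ez] zy]] := Ez.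
have dz := majorized_dominated Py Pz zy.
have dv : dominated y (w - z) by apply/dominated_add/dominated_opp.
have e20 : 0 < e / 2 by lra.
have [d d0 hd] := dominated_small Py e20 dv.
exists d => // t /andP[dt td].
(* Since [e y < z] and [- t (w - z) < (e / 2) y], the displacement uses up at most half of the
   margin, and [(e / 2) y] remains below the moved point. *)
have ryz : r (e / 2 *: y) (z + t *: (w - z)).
  have /hd rt : - d < - t < d by apply/andP; split; lra.
  have := pref_addr (t *: (w - z) - (e / 2) *: y) (pref_add ez rt); congr (r _ _).
    by rewrite scaleNr addrA subrK -scalerBl; congr (_ *: _); lra.
  by rewrite addrACA subrr addr0.
split; first exact: cone_of_pref ryz.
split; first by exists (e / 2).
(* The converse majorization holds for every [t], because [z] and [w - z] both lie in the subspace
   [dominated y]. *)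
by apply/dominated_majorized/dominated_add/dominated_scale.
Qed.

(** * The order on open components and its suprema *)

Lemma component_leP {y z} : P y -> P z ->
  component_le r [comp y] [comp z] <-> majorized r y z.
Proof.
move=> Py Pz; split=> [|yz u v [_ [_ uy]] [_ [zv _]]].
  by apply; apply: component_id.
exact: majorized_trans uy (majorized_trans yz zv).
Qed.

Lemma component_le_partial_order :
  partial_order_on (open_components r) (component_le r).
Proof.
split=> [_ [y Py <-]|_ _ [y Py <-] [z Pz <-]|_ _ _ [y Py <-] [z Pz <-] [w Pw <-]].
- exact/component_leP/majorized_refl.
- move=> /(component_leP Py Pz) yz /(component_leP Pz Py) zy.
  (* Representatives that majorize each other have the same component, by transitivity on either
     side. *)
  apply/seteqP; split=> u [Pu [lu ul]]; split=> //; split.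
  + exact: majorized_trans zy lu.
  + exact: majorized_trans ul yz.
  + exact: majorized_trans yz lu.
  + exact: majorized_trans ul zy.
- move=> /(component_leP Py Pz) yz /(component_leP Pz Pw) zw.
  exact/component_leP/(majorized_trans yz).
Qed.

Lemma component_lub y z : P y -> P z ->
  is_lub_in (open_components r) (component_le r) [set [comp y]; [comp z]] [comp y + z].
Proof.
move=> Py Pz; have Pyz := cone_add Py Pz; split; first by exists (y + z).
- move=> _ [|] /= ->; apply/component_leP => //.
    exact/majorized_addr/majorized_refl.
  by rewrite addrC; apply/majorized_addr/majorized_refl.
- move=> _ [w Pw <-] ub; apply/component_leP => //.
  by apply: majorized_add => //; apply/component_leP => //; apply: ub; [left|right].
Qed.

(** * Transfer from components to the preferences they define *)

Lemma component_prefs_partial_order :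
  partial_order_on (component_prefs r) (component_pref_le r).
Proof.
have [rf asym tr] := component_le_partial_order.
split=> [_ [E OE <-]|_ _ [E OE <-] [F OF <-]|_ _ _ [E OE <-] [F OF <-] [G OG <-]].
- exact/component_pref_leE/rf.
- by rewrite !component_pref_leE // => EF FE; rewrite (asym E F).
- by rewrite !component_pref_leE //; apply: tr.
Qed.

(** By injectivity, [pref_of] is an order isomorphism from the components onto [component_prefs r],
    so it carries any least upper bound to one. *)
Lemma component_prefs_lub E1 E2 E : open_components r E1 -> open_components r E2 ->
  is_lub_in (open_components r) (component_le r) [set E1; E2] E ->
  is_lub_in (component_prefs r) (component_pref_le r)
    [set pref_of E1; pref_of E2] (pref_of E).
Proof.
move=> O1 O2 [OE ub least]; split; first by exists E.
- by move=> _ [|] /= ->; apply/component_pref_leE => //; apply: ub; [left|right].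
- move=> _ [F OF <-] ubF; apply/component_pref_leE => //; apply: least => // G [|] /= ->.
    by apply/component_pref_leE => //; apply: ubF; left.
  by apply/component_pref_leE => //; apply: ubF; right.
Qed.

End CompatiblePreference.

Theorem theorem3p15 (R : realType) (Y : lmodType R) (r : Y -> Y -> Prop)
    (hr : compatible_partial_preference r) :
  [/\ (forall s, component_prefs r s ->
         compatible_partial_preference s /\ relatively_open s),
      upper_lattice (component_prefs r) (component_pref_le r),
      (forall E1 E2, open_components r E1 -> open_components r E2 ->
         (exists E, is_lub_in (open_components r) (component_le r)
                      [set E1; E2] E) /\
         (forall E, is_lub_in (open_components r) (component_le r)
                      [set E1; E2] E ->
            is_lub_in (component_prefs r) (component_pref_le r)
              [set pref_of E1; pref_of E2] (pref_of E))) &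
      (forall y z, r y z <-> exists2 s, component_prefs r s & s y z)].
Proof.
have lub E1 E2 : open_components r E1 -> open_components r E2 ->
    exists E, is_lub_in (open_components r) (component_le r) [set E1; E2] E.
  by move=> [y Py <-] [z Pz <-]; eexists; apply: component_lub.
split.
- move=> _ [_ [y Py <-] <-]; split; first exact: pref_of_component_compatible.
  rewrite /relatively_open positive_cone_pref_of icr_component //; split=> //.
  by exists y; apply: component_id.
- split; first exact: component_prefs_partial_order.
  move=> _ _ [E1 O1 <-] [E2 O2 <-] _; have [E lubE] := lub _ _ O1 O2.
  by exists (pref_of E); apply: component_prefs_lub.
- move=> E1 E2 O1 O2; split; first exact: lub.
  by move=> E; apply: component_prefs_lub.
(* The witness is the component of [z - y], which contains [z - y]; conversely, every component lies
   inside the positive cone. *)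
- move=> y z; split=> [/(cone_sub hr) Pyz|[_ [_ [x Px <-] <-] [Pyz _]]].
    exists (pref_of (open_component_of r (z - y))); last exact: component_id.
    by eexists; last reflexivity; exists (z - y).
  exact: (pref_of_cone_sub hr).
Qed.
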